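(* Consider the borrowed betting game with borrowings $\{\beta_t\}_{t\ge1}$, wealth process $\{W_t\}_{t\ge0}$, $W_0=1$, and liabilities $\{L_t\}_{t\ge0}$, under the supermartingale null $\mathbb{P}_{\mathsf S}$. Assume that $\{L_t\}$ is non-decreasing, i.e. $\mathbb{P}_{\mathsf S}(\beta_t\ge 0)=1$ for all $t\ge 1$. Then, for any function $g:[0,\infty)\to[1,\infty)$ such that $\ell\mapsto g(\ell)-\ell$ is increasing (in the weak sense), $$\mathbb{P}_{\mathsf S}\left(\exists t\ge 0,\ W_t\ge g(L_t)\right)\ \le\ 1-\frac{g(0)-1}{g(0)}\exp\left(-\int_0^\infty\frac{1}{g(\ell)}\,\mathrm{d}\ell\right).$$ Additionally, this inequality is tight in the sense that, for every fixed such $g$, $$\sup\ \mathbb{P}_{\mathsf S}\left(\exists t\ge 0,\ W_t\ge g(L_t)\right)\ =\ 1-\frac{g(0)-1}{g(0)}\exp\left(-\int_0^\infty\frac{1}{g(\ell)}\,\mathrm{d}\ell\right),$$ where the supremum is over all possible instances $(\{B_t\},\{\beta_t\})$ of the borrowed betting game (on any filtered probability space) satisfying the supermartingale null and having non-decreasing liabilities.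
   Context: Borrowed betting game. Let $(\Omega,\mathcal{A},\mathbb{P})$ be a probability space with a discrete-time filtration $\{\mathcal{F}_t\}_{t\ge0}$, $t=0,1,2,\dots$. Let $\{B_t\}_{t\ge1}$ be a nonnegative process adapted to $\{\mathcal{F}_t\}$ (the per-unit payoffs), and let $\{\beta_t\}_{t\ge1}$ (the borrowed amounts) be predictable, i.e. $\beta_t$ is $\mathcal{F}_{t-1}$-measurable, with $\beta_t\ge -W_{t-1}$ for each $t$. The wealth process is $W_0=1$ and $W_t=(W_{t-1}+\beta_t)\cdot B_t$ for $t\ge1$. The liabilities process is $L_0=0$, $L_t=\sum_{i=1}^t\beta_i$. Supermartingale null: $\mathbb{E}(B_t\mid\mathcal{F}_{t-1})\le1$ for all $t\ge1$; when this holds the probability is denoted $\mathbb{P}_{\mathsf S}$. Convention: $\exp(-\infty)=0$ if the integral diverges. *)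

(* Defs.v *)
From mathcomp Require Import all_boot all_order all_algebra.
From mathcomp Require Import all_classical all_reals all_analysis.
From mathcomp Require Import measurable_realfun.

Set Implicit Arguments.
Unset Strict Implicit.
Unset Printing Implicit Defensive.

Import Order.TTheory GRing.Theory Num.Theory.
Import numFieldNormedType.Exports.

Local Open Scope classical_set_scope.
Local Open Scope ring_scope.

Record filtration (d : measure_display) (T : measurableType d)
    (F : nat -> set (set T)) : Prop := Filtration {
  filtration_sigma : forall t, sigma_algebra setT (F t);
  filtration_sub : forall t, F t `<=` measurable;
  filtration_nondecreasing : forall s t, (s <= t)%N -> F s `<=` F t }.

Definition measurable_wrt (d : measure_display) (T : measurableType d)
    (G : set (set T)) (d' : measure_display) (U : measurableType d')
    (X : T -> U) : Prop :=
  measurable_fun setT (X : g_sigma_algebraType G -> U).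

(* Y is a version of E(X | G), for a nonnegative X which need not be
   integrable; this is why versions take values in [0, +oo]. *)
Record cond_expectation (R : realType) (d : measure_display)
    (T : measurableType d) (P : probability T R) (G : set (set T))
    (X : T -> R) (Y : T -> \bar R) : Prop := CondExpectation {
  cond_expectation_ge0 : forall w, (0 <= Y w)%E;
  cond_expectation_measurable : measurable_wrt G Y;
  cond_expectation_integral : forall A, G A ->
    (\int[P]_(w in A) Y w = \int[P]_(w in A) (X w)%:E)%E }.

(* Payoffs and borrowings are processes indexed from 1: the values B 0 and
   beta 0 play no role anywhere below. *)
Fixpoint wealth (R : realType) (T : Type) (B beta : nat -> T -> R)
    (t : nat) (w : T) : R :=
  if t is s.+1 then (wealth B beta s w + beta t w) * B t w else 1.

Definition liabilities (R : realType) (T : Type) (beta : nat -> T -> R)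
    (t : nat) (w : T) : R :=
  \sum_(1 <= i < t.+1) beta i w.

Record borrowed_betting_game (R : realType) (d : measure_display)
    (T : measurableType d) (F : nat -> set (set T))
    (B beta : nat -> T -> R) : Prop := BorrowedBettingGame {
  game_filtration : filtration F;
  game_payoff_ge0 : forall t w, 0 <= B t.+1 w;
  game_payoff_adapted : forall t, measurable_wrt (F t.+1) (B t.+1);
  game_borrowing_predictable : forall t, measurable_wrt (F t) (beta t.+1);
  game_borrowing_ge : forall t w, - wealth B beta t w <= beta t.+1 w }.

(* Versions of the conditional expectation exist and agree almost surely, so
   it does not matter which one is taken. *)
Definition supermartingale_null (R : realType) (d : measure_display)
    (T : measurableType d) (P : probability T R) (F : nat -> set (set T))
    (B : nat -> T -> R) : Prop :=
  forall t, exists2 Y : T -> \bar R,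
    cond_expectation P (F t) (B t.+1) Y & {ae P, forall w, (Y w <= 1)%E}.

Definition nondecreasing_liabilities (R : realType) (d : measure_display)
    (T : measurableType d) (P : probability T R)
    (beta : nat -> T -> R) : Prop :=
  forall t, P [set w | 0 <= beta t.+1 w] = 1%E.

(* The boundary g is a function on [0, +oo[, so the event W_t >= g(L_t) only
   makes sense where L_t >= 0; liabilities that are nondecreasing almost surely
   may be negative on a null set, where the values of g : R -> R are junk. *)
Definition crossing_event (R : realType) (T : Type) (g : R -> R)
    (B beta : nat -> T -> R) : set T :=
  [set w | exists t, 0 <= liabilities beta t w /\
                     g (liabilities beta t w) <= wealth B beta t w].

Definition boundary (R : realType) (g : R -> R) : Prop :=
  (forall l, 0 <= l -> 1 <= g l) /\
  (forall l1 l2, 0 <= l1 -> l1 <= l2 -> g l1 - l1 <= g l2 - l2).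

(* expeR -oo = 0, which covers a divergent integral. *)
Definition crossing_bound (R : realType) (g : R -> R) : \bar R :=
  (1 - ((g 0%R - 1) / g 0%R)%:E *
       expeR (- \int[lebesgue_measure]_(l in `[0%R, +oo[) ((g l)^-1)%:E))%E.

(* Main.v *)
Require Import Defs.
From mathcomp Require Import all_boot all_order all_algebra.
From mathcomp Require Import all_classical all_reals all_analysis.
From mathcomp Require Import measurable_realfun.
From mathcomp Require Import ring lra.

(** Upper bound.  From wealth [w] and liabilities [l], with [w < g l], whatever
    the gambler does, the boundary is never crossed with probability at least
      [(1 - w / g l) * survival g l],
    where [survival g l = exp (- \int_l^oo 1 / g)].  Call this value, set to [0]
    after the crossing, the deficit; it is shown to be a submartingale, so
    that its mean is never below its starting value
      [(1 - 1 / g 0) * survival g 0],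
    and it is at most the indicator of not having crossed yet.

    A round consists of a borrowing and a bet.  The borrowing does not decrease
    the deficit ([borrowing_step]): since [g l - l] is nondecreasing, on the
    interval from [l] to [l + b] the boundary is below the line [c + (x - l)]
    through its right end, so the integral of [1 / g] there is at least a
    difference of logarithms, which is what the deficit needs.  The bet does not
    decrease its mean, because before the crossing the deficit is affine in the
    wealth with the negative slope [- survival g l / g l], a payoff with
    conditional mean at most [1] does not increase the mean of the wealth, even
    with a weight known beforehand ([integral_mul_le]), and truncating at [0]
    only increases the deficit.  When [\int_0^oo 1 / g] diverges the bound is
    [1] and there is nothing to prove.

    Tightness.  The two inequalities become equalities in the limit for the
    gambler who first bets the initial wealth, then borrows [e] in every round,
    and always stakes everything on reaching the boundary exactly or losing all.
    Such a game needs only the time of the success, so it lives on the unit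
    interval: the game succeeds in round [t + 1] at the points [w] with
    [alive (t + 1) <= w < alive t], where [alive t] is the probability of failing
    in the first [t] rounds.  The probability of never crossing is at most
    [1 - 1 / g 0] times a product of terms
      [1 - e / g (k * e) <= exp (- e / g (k * e))],
    and since [1 / g] is nonincreasing the sum in the exponent dominates the
    integral of [1 / g] up to one step ([alive_le_expR]).  Letting [e] go to [0]
    and the horizon to infinity together gives the bound ([cvg_fine_bound]). *)

Set Implicit Arguments.
Unset Strict Implicit.
Unset Printing Implicit Defensive.

Import Order.TTheory GRing.Theory Num.Theory.
Import numFieldNormedType.Exports.

Local Open Scope classical_set_scope.
Local Open Scope ring_scope.

(** * Weights measurable for a smaller sigma-algebra *)

Section sub_sigma_algebra.
Context (R : realType) (d : measure_display) (T : measurableType d).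
Context (P : probability T R) (G : set (set T)).
Hypotheses (sG : sigma_algebra setT G) (Gm : G `<=` measurable).

Lemma measurable_sub (A : set (g_sigma_algebraType G)) :
  measurable A -> G A.
Proof. by rewrite measurable_g_measurableTypeE. Qed.

Lemma measurable_wrtW d' (U : measurableType d') (X : T -> U) :
  measurable_wrt G X -> measurable_fun setT X.
Proof.
move=> mX _ Y mY; apply: Gm; apply: measurable_sub; exact: mX.
Qed.

Import HBNNSimple.

(** A simple function is a nonnegative combination of indicators of events of
    [G], and on each of them the bound is the hypothesis on [X]. *)
Lemma integral_mul_nnsfun_le (X : T -> R)
    (s : {nnsfun g_sigma_algebraType G >-> R}) :
  measurable_fun setT X -> (forall w, 0 <= X w) ->
  (forall A, G A -> (\int[P]_(w in A) (X w)%:E <= P A)%E) ->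
  (\int[P]_w (s w * X w)%:E <= \int[P]_w (s w)%:E)%E.
Proof.
move=> mX X0 XG.
pose A y : set T := s @^-1` [set y].
have Gs y : G (A y) by apply: measurable_sub; exact: measurable_funPTI.
have ms y : measurable (A y) by apply: Gm.
have rs y : range s y -> 0 <= y by move=> [x _ <-].
have E (Y : T -> R) : measurable_fun setT Y -> (forall w, 0 <= Y w) ->
    (\int[P]_w (s w * Y w)%:E =
     \sum_(y \in range s) y%:E * \int[P]_(w in A y) (Y w)%:E)%E.
  move=> mY Y0; pose Z y : T -> \bar R := (fun w => (Y w)%:E) \_ (A y).
  have mZ y : measurable_fun setT (Z y).
    apply: (iffLR (measurable_restrictT _ (ms y))).
    exact/measurable_funTS/measurable_EFinP.
  have Z0 y w : (0 <= Z y w)%E.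
    by rewrite /Z patchE; case: ifPn => // _; rewrite lee_fin.
  transitivity (\int[P]_w \sum_(y \in range s) (y%:E * Z y w))%E.
    apply: eq_integral => w _.
    rewrite [X in (X * _)%:E]fimfunE mulr_fsuml -fsumEFin//.
    apply: eq_fsbigr => y _.
    by rewrite /Z patchE indicE /A; case: ifPn; rewrite ?mulr1 ?mulr0 ?mul0r ?mule0.
  rewrite ge0_integral_fsum//; last 2 first.
  - by move=> y; exact: measurable_funeM.
  - move=> y w _; rewrite /Z patchE; case: ifPn => [|_]; last by rewrite mule0.
    by rewrite inE /A => /= <-; rewrite mule_ge0 ?lee_fin.
  apply: eq_fsbigr => y; rewrite inE => /rs y0.
  by rewrite ge0_integralZl// /Z -integral_mkcond.
under [leRHS]eq_integral do rewrite -[s _]mulr1.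
rewrite E// (E (cst 1))//.
apply: lee_fsum => // y sy.
rewrite lee_wpmul2l ?lee_fin ?rs// (@integral_cst _ _ _ P _ (ms y) 1%E) mul1e.
exact: XG.
Qed.

(** The bound on the events of [G] extends to nonnegative [G]-measurable weights
    by monotone approximation with simple functions, all of which are again
    [G]-measurable. *)
Lemma integral_mul_le (X C : T -> R) :
  measurable_fun setT X -> (forall w, 0 <= X w) ->
  (forall A, G A -> (\int[P]_(w in A) (X w)%:E <= P A)%E) ->
  measurable_wrt G C -> (forall w, 0 <= C w) ->
  (\int[P]_w (C w * X w)%:E <= \int[P]_w (C w)%:E)%E.
Proof.
move=> mX X0 XG mC C0.
have mC' : measurable_fun setT
    ((fun w => (C w)%:E) : g_sigma_algebraType G -> \bar R).
  exact/measurable_EFinP.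
pose s n := nnsfun_approx measurableT mC' n.
have ms n : measurable_fun setT (s n : T -> R).
  by apply: measurable_wrtW; exact: measurable_funPT.
have nds w : {homo s^~ w : m n / (m <= n)%N >-> m <= n}.
  by move=> m n mn; exact/lefP/nd_nnsfun_approx.
have cs w : (s n w)%:E @[n --> \oo] --> (C w)%:E.
  by apply: cvg_nnsfun_approx => // x _; rewrite lee_fin.
have les w n : s n w <= C w.
  have nde : nondecreasing_seq (fun n => (s n w)%:E).
    by move=> m k mk; rewrite lee_fin nds.
  rewrite -lee_fin (cvg_unique _ (cs w) (ereal_nondecreasing_cvgn nde))//.
  by apply: ereal_sup_ubound; exists n.
have -> : (\int[P]_w (C w * X w)%:E =
    limn (fun n => \int[P]_w (s n w * X w)%:E))%E.
  rewrite -monotone_convergence//.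
  - apply: eq_integral => w _; apply/esym/cvg_lim => //.
    under eq_fun do rewrite EFinM.
    by rewrite EFinM; apply: cvgeZr.
  - by move=> n; apply/measurable_EFinP/measurable_funM.
  - by move=> n w _; rewrite lee_fin mulr_ge0.
  - by move=> w _ m n mn; rewrite lee_fin ler_wpM2r// nds.
apply: lime_le.
  apply: ereal_nondecreasing_is_cvgn => m n mn; apply: ge0_le_integral => //.
  - by move=> w _; rewrite lee_fin mulr_ge0.
  - by apply/measurable_EFinP/measurable_funM.
  - by apply/measurable_EFinP/measurable_funM.
  - by move=> w _; rewrite lee_fin ler_wpM2r// nds.
apply: nearW => n; apply: le_trans (integral_mul_nnsfun_le (s n) mX X0 XG) _.
apply: ge0_le_integral => //.
- by move=> w _; rewrite lee_fin.
- exact/measurable_EFinP.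
- exact/measurable_EFinP/measurable_wrtW.
- by move=> w _; rewrite lee_fin.
Qed.

End sub_sigma_algebra.

(** * The integral of the inverse boundary *)

Lemma integral_inv_shift (R : realType) (a b c : R) : a < b -> 0 < c ->
  (\int[lebesgue_measure]_(x in `[a, b]) ((c + (x - a))^-1)%:E
   = (ln (c + (b - a)) - ln c)%:E)%E.
Proof.
move=> ab c0.
pose F x := ln (c + (x - a)).
have pos x : a <= x -> 0 < c + (x - a).
  by move=> ax; rewrite ltr_wpDr// subr_ge0.
have dF x : a <= x -> is_derive x 1 F (c + (x - a))^-1.
  move=> ax; have dln := is_derive1_ln (pos _ ax).
  have da : is_derive x 1 (fun y : R => c + (y - a)) 1.
    by apply: is_derive_eq; rewrite add0r subr0 mulr1.
  have := @is_derive1_comp _ (@ln R) _ x _ _ dln da.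
  by rewrite mulr1.
have cF x : a <= x -> {for x, continuous F}.
  move=> ax; apply/differentiable_continuous/derivable1_diffP/ex_derive.
  exact: dF.
rewrite (@continuous_FTC2 _ _ F)//.
- by rewrite /F subrr addr0 EFinB.
- apply: continuous_in_subspaceT => x; rewrite inE/= in_itv/= => /andP[ax _].
  apply: cvgV; first by rewrite gt_eqF// pos.
  by apply: cvgD; [exact: cvg_cst|apply: cvgB; [exact: cvg_id|exact: cvg_cst]].
- split.
  + by move=> x; rewrite in_itv/= => /andP[/ltW ax _]; apply: ex_derive; exact: dF.
  + by apply: cvg_at_right_filter; exact: cF.
  + by apply: cvg_at_left_filter; apply: cF; exact: ltW.
- move=> x; rewrite in_itv/= => /andP[/ltW ax _].
  by rewrite derive1E; have [_ ->] := dF _ ax.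
Qed.

Section tail_integral.
Context (R : realType) (g : R -> R).
Hypothesis g1 : forall l, 1 <= g l.
Hypothesis ndg : forall l1 l2, l1 <= l2 -> g l1 <= g l2.
Hypothesis ndgB : forall l1 l2, 0 <= l1 -> l1 <= l2 -> g l1 - l1 <= g l2 - l2.

Notation mu := lebesgue_measure.

Definition tail_integral (l : R) : \bar R :=
  (\int[mu]_(x in `[l, +oo[) ((g x)^-1)%:E)%E.

Let g0 l : 0 < g l. Proof. exact: lt_le_trans (g1 l). Qed.

Lemma measurable_inv_boundary (D : set R) : measurable D ->
  measurable_fun D (fun x => ((g x)^-1)%:E).
Proof.
move=> mD; apply/measurable_EFinP; apply: nonincreasing_measurable => // x y xy.
by rewrite lef_pV2 ?posrE ?ndg.
Qed.

Lemma tail_integral_split (a b : R) : a <= b ->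
  (tail_integral a =
   \int[mu]_(x in `[a, b[) ((g x)^-1)%:E + tail_integral b)%E.
Proof.
move=> ab; rewrite /tail_integral -ge0_integral_setU//.
- by rewrite -itv_bndbnd_setU//= bnd_simp.
- by apply: measurable_inv_boundary; apply: measurableU; exact: measurable_itv.
- by move=> x _; rewrite lee_fin invr_ge0 ltW.
- apply/disj_setPS => x [] /=; rewrite !in_itv/= andbT => /andP[_ xb] bx.
  by rewrite leNgt xb in bx.
Qed.

Lemma tail_integral_ge0 l : (0 <= tail_integral l)%E.
Proof. by apply: integral_ge0 => x _; rewrite lee_fin invr_ge0 ltW. Qed.

Lemma integral_inv_boundary_ge (a b c : R) : a < b -> 0 < c ->
  (forall x, a <= x <= b -> g x <= c + (x - a)) ->
  ((ln (c + (b - a)) - ln c)%:E <=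
   \int[mu]_(x in `[a, b[) ((g x)^-1)%:E)%E.
Proof.
move=> ab c0 gc.
rewrite -integral_inv_shift// integral_itv_bndo_bndc; last first.
  exact: measurable_inv_boundary.
apply: ge0_le_integral => //.
- move=> x /=; rewrite in_itv/= => /andP[ax _].
  by rewrite lee_fin invr_ge0 addr_ge0 ?(ltW c0) ?subr_ge0.
- apply/measurable_EFinP; apply: subspace_continuous_measurable_fun => //.
  apply: continuous_in_subspaceT => x; rewrite inE/= in_itv/= => /andP[ax _].
  apply: cvgV; first by rewrite gt_eqF// ltr_wpDr// subr_ge0.
  by apply: cvgD; [exact: cvg_cst|apply: cvgB; [exact: cvg_id|exact: cvg_cst]].
- exact: measurable_inv_boundary.
- move=> x /=; rewrite in_itv/= => axb.
  have gx := gc _ axb; rewrite lee_fin lef_pV2 ?posrE//.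
  exact: lt_le_trans (g0 x) gx.
Qed.

Hypothesis tail_fin : (tail_integral 0 < +oo)%E.

(** Truncating [l] at [0] keeps the integral below the finite one from [0], so
    that [survival] is monotone, hence Borel, on the whole line. *)
Definition survival (l : R) : R := expR (- fine (tail_integral (Num.max l 0))).

Lemma tail_integral_fin_num l : 0 <= l -> tail_integral l \is a fin_num.
Proof.
move=> l0; rewrite ge0_fin_numE ?tail_integral_ge0//.
apply: le_lt_trans tail_fin; rewrite (tail_integral_split l0) leeDr//.
by apply: integral_ge0 => x _; rewrite lee_fin invr_ge0 ltW.
Qed.

Lemma survival_gt0 l : 0 < survival l.
Proof. exact: expR_gt0. Qed.

Lemma survival_le1 l : survival l <= 1.
Proof.
by rewrite -expR0 ler_expR oppr_le0 fine_ge0// tail_integral_ge0.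
Qed.

Lemma survival_nondecreasing : nondecreasing_fun survival.
Proof.
move=> a b ab; rewrite ler_expR lerN2.
have ab0 : Num.max a 0 <= Num.max b 0 by rewrite ge_max !le_max ab lexx orbT.
rewrite fine_le// ?tail_integral_fin_num ?le_max ?lexx ?orbT//.
rewrite (tail_integral_split ab0) leeDr//.
by apply: integral_ge0 => x _; rewrite lee_fin invr_ge0 ltW.
Qed.

(** Exponential form of [integral_inv_boundary_ge]: the integral of the inverse
    of the line [c + (x - l)] is a logarithm, so that [survival] grows at least
    as fast as the line. *)
Lemma survival_ratio (l b c : R) : 0 <= l -> 0 <= b -> 0 < c ->
  (forall x, l <= x <= l + b -> g x <= c + (x - l)) ->
  survival l * (c + b) <= survival (l + b) * c.
Proof.
move=> l0; rewrite le_eqVlt => /predU1P[<- c0 _|b0 c0 gc].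
  by rewrite !addr0.
have llb : l < l + b by rewrite ltrDl.
have lb0 : 0 <= l + b by rewrite addr_ge0// ltW.
rewrite /survival !max_l//.
have := integral_inv_boundary_ge llb c0 gc; rewrite addrAC subrr add0r.
have := tail_integral_split (ltW llb).
have := tail_integral_fin_num l0; have := tail_integral_fin_num lb0.
case: (tail_integral (l + b)) => // v _; case: (tail_integral l) => // u _.
case: (\int[mu]_(x in _) _)%E => // i [->]; rewrite lee_fin => Hi/=.
rewrite opprD expRD mulrAC mulrC ler_pM2l ?expR_gt0//.
have cb0 : 0 < c + b by rewrite addr_gt0.
rewrite -[in leLHS](@lnK _ (c + b)) ?posrE// -expRD.
rewrite -[in leRHS](@lnK _ c) ?posrE// ler_expR.
by rewrite addrC lerBlDr; rewrite lerBlDl in Hi.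
Qed.

(** Borrowing [b] leaves the gap [g l - l] no smaller, hence also the distance
    [D] from the wealth to the boundary.  The deficit after the borrowing is
    [D / g (l + b)] times the new [survival]; by [survival_ratio] with
    [c = D + w] this is at least [D / (D + w)] times the old one, and
    [D / (D + w)] increases with [D]. *)
Lemma borrowing_step (l b w : R) : 0 <= l -> 0 <= b -> 0 <= w -> w < g l ->
  (1 - w / g l) * survival l <= (1 - (w + b) / g (l + b)) * survival (l + b).
Proof.
move=> l0 b0 w0 wg.
set D := g (l + b) - (w + b).
(* The line of slope 1 through the right end of the graph of g. *)
have gB x : l <= x <= l + b -> g x <= D + w + (x - l).
  move=> /andP[lx xlb]; have := ndgB (le_trans l0 lx) xlb.
  by rewrite /D; lra.
have D0 : 0 < D.
  by have := ndgB l0 (_ : l <= l + b); rewrite lerDl b0 => /(_ isT); rewrite /D; lra.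
have c0 : 0 < D + w by lra.
have := survival_ratio l0 b0 c0 gB.
have -> : D + w + b = g (l + b) by rewrite /D; lra.
have gl : g l <= D + w by rewrite (le_trans (gB l _)) ?lexx ?lerDl//; lra.
move=> H.
have -> : 1 - (w + b) / g (l + b) = D / g (l + b).
  by rewrite /D; field; rewrite gt_eqF.
apply: (@le_trans _ _ (D / (D + w) * survival l)).
  apply: ler_wpM2r; first exact/ltW/survival_gt0.
  have -> : D / (D + w) = 1 - w / (D + w) by field; rewrite gt_eqF.
  by rewrite lerD2l lerN2 ler_wpM2l// lef_pV2 ?posrE.
rewrite mulrAC [leRHS]mulrAC -!mulrA ler_pM2l//.
by rewrite ler_pdivrMr// mulrAC ler_pdivlMr// mulrC.
Qed.

End tail_integral.

(** * The upper bound *)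

Section upper_bound.
Context (R : realType) (d : measure_display) (T : measurableType d).
Context (P : probability T R) (F : nat -> set (set T)) (B beta : nat -> T -> R).
Hypothesis game : borrowed_betting_game F B beta.

Local Notation W := (wealth B beta).
Local Notation L := (liabilities beta).

Lemma measurable_wrt_mono (G1 G2 : set (set T)) d' (U : measurableType d')
    (X : T -> U) :
  sigma_algebra setT G1 -> sigma_algebra setT G2 -> G1 `<=` G2 ->
  measurable_wrt G1 X -> measurable_wrt G2 X.
Proof.
move=> s1 s2 G12 mX _ Y mY.
suff : G2 (setT `&` X @^-1` Y).
  by rewrite -[in G2 _](measurable_g_measurableTypeE s2).
apply: G12; apply: measurable_sub => //; exact: mX.
Qed.

Let sF t : sigma_algebra setT (F t).
Proof. by case: game => -[]. Qed.

Let Fm t : F t `<=` measurable.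
Proof. by case: game => -[]. Qed.

Let FS t d' (U : measurableType d') (X : T -> U) :
  measurable_wrt (F t) X -> measurable_wrt (F t.+1) X.
Proof.
apply: measurable_wrt_mono => //; case: game => -[_ _ ndF] _ _ _ _.
exact: ndF.
Qed.

Lemma liabilities0 w : L 0 w = 0.
Proof. by rewrite /liabilities big_geq. Qed.

Lemma liabilitiesS t w : L t.+1 w = L t w + beta t.+1 w.
Proof. by rewrite /liabilities big_nat_recr. Qed.

Lemma wealth_ge0 t w : 0 <= W t w.
Proof.
case: t => [|t] //=; rewrite mulr_ge0 ?(game_payoff_ge0 game)//.
by rewrite -[X in X + _]opprK addrC subr_ge0 (game_borrowing_ge game).
Qed.

Lemma stake_ge0 t w : 0 <= W t w + beta t.+1 w.
Proof. by rewrite -[X in X + _]opprK addrC subr_ge0 (game_borrowing_ge game). Qed.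

Lemma measurable_wealth t : measurable_wrt (F t) (W t).
Proof.
elim: t => [|t IH]; first exact: measurable_cst.
apply: measurable_funM; last exact: (game_payoff_adapted game).
apply: FS; apply: measurable_funD => //.
exact: (game_borrowing_predictable game).
Qed.

Lemma measurable_stake t : measurable_wrt (F t) (fun w => W t w + beta t.+1 w).
Proof.
apply: measurable_funD; first exact: measurable_wealth.
exact: (game_borrowing_predictable game).
Qed.

Lemma measurable_liabilitiesS t : measurable_wrt (F t) (L t.+1).
Proof.
have E s : L s.+1 = (fun w => L s w + beta s.+1 w).
  by apply/funext => w; rewrite liabilitiesS.
elim: t => [|t IH].
  rewrite E; apply: measurable_funD; last exact: (game_borrowing_predictable game).
  rewrite (_ : L 0 = cst 0); first exact: measurable_cst.
  by apply/funext => w; rewrite liabilities0.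
rewrite E; apply: measurable_funD; first exact: FS.
exact: (game_borrowing_predictable game).
Qed.

Lemma measurable_liabilities t : measurable_wrt (F t) (L t).
Proof.
case: t => [|t]; last by apply: FS; exact: measurable_liabilitiesS.
rewrite (_ : L 0 = cst 0); first exact: measurable_cst.
by apply/funext => w; rewrite liabilities0.
Qed.

Lemma measurable_crossing_event (g : R -> R) : measurable_fun setT g ->
  measurable (crossing_event g B beta).
Proof.
move=> mg.
rewrite (_ : crossing_event g B beta =
  \bigcup_t [set w | (0 <= L t w) && (g (L t w) <= W t w)]); last first.
  by apply/seteqP; split => w [t]; [move=> [a b]; exists t => //=; rewrite a|
    move=> _ /andP[a b]; exists t].
apply: bigcupT_measurable => t.
have mb : measurable_wrt (F t) (fun w => (0 <= L t w) && (g (L t w) <= W t w)).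
  have mL := @measurable_liabilities t.
  apply: measurable_and; apply: measurable_fun_ler => //.
    exact: (measurableT_comp mg mL).
  exact: measurable_wealth.
have := measurable_wrtW (sF t) (@Fm t) mb measurableT (_ : measurable [set true]).
by move=> /(_ I); rewrite setTI.
Qed.

Hypothesis null : supermartingale_null P F B.

(** The upper bound uses the null hypothesis in this form only, so no version of
    a conditional expectation is manipulated afterwards. *)
Lemma payoff_integral_le t A : F t A ->
  (\int[P]_(w in A) (B t.+1 w)%:E <= P A)%E.
Proof.
move=> FA; have [Y [Y0 mY YB] Y1] := null t.
have mA := Fm FA.
rewrite -YB// -[leRHS]mul1e -(@integral_cst _ _ _ P _ mA 1%E).
apply: ae_ge0_le_integral => //.
- by apply: measurable_funTS; exact: (measurable_wrtW (sF t) (@Fm t)).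
- by apply: filterS Y1 => w Yw _.
Qed.

Hypothesis ndL : nondecreasing_liabilities P beta.

Lemma ae_borrowing_ge0 : {ae P, forall w, forall t, 0 <= beta t.+1 w}.
Proof.
apply/ae_foralln => t.
have mb : measurable_fun setT (beta t.+1).
  apply: (measurable_wrtW (sF t) (@Fm t)).
  exact: (game_borrowing_predictable game).
have mS : measurable [set w | 0 <= beta t.+1 w].
  have -> : [set w | 0 <= beta t.+1 w] = setT `&` beta t.+1 @^-1` `[0, +oo[.
    by apply/seteqP; split => w /=; rewrite in_itv/= andbT // => -[].
  exact: mb.
exists (~` [set w | 0 <= beta t.+1 w]); split.
- exact: measurableC.
- by apply: etrans (probability_setC P mS) _; rewrite ndL subee.
- by [].
Qed.

Variable g : R -> R.
Hypothesis g1 : forall l, 1 <= g l.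
Hypothesis ndg : forall l1 l2, l1 <= l2 -> g l1 <= g l2.
Hypothesis ndgB : forall l1 l2, 0 <= l1 -> l1 <= l2 -> g l1 - l1 <= g l2 - l2.
Hypothesis tail_fin : (tail_integral g 0 < +oo)%E.

Let g0 l : 0 < g l. Proof. exact: lt_le_trans (g1 l). Qed.

(** Crossing is tested without the condition [0 <= L t w]: it holds almost
    surely, and dropping it only enlarges the event of having crossed. *)
Fixpoint uncrossed (t : nat) (w : T) : bool :=
  (if t is s.+1 then uncrossed s w else true) && (W t w < g (L t w)).

Lemma uncrossedE t w : uncrossed t w -> W t w < g (L t w).
Proof. by case: t => [|t] /andP[]. Qed.

Let mg : measurable_fun setT g.
Proof. exact: (nondecreasing_measurable measurableT ndg). Qed.

Let msurv : measurable_fun setT (survival g).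
Proof.
apply: nondecreasing_measurable => //; exact: survival_nondecreasing.
Qed.

Lemma measurable_uncrossed t : measurable_wrt (F t) (uncrossed t).
Proof.
have m s : measurable_wrt (F s) (fun w => W s w < g (L s w)).
  apply: measurable_fun_ltr; first exact: measurable_wealth.
  exact: (measurableT_comp mg (@measurable_liabilities s)).
elim: t => [|t IH]; first by apply: measurable_and => //; exact: m.
by apply: measurable_and; [exact: FS|exact: m].
Qed.

Definition deficit (t : nat) (w : T) : R :=
  (uncrossed t w)%:R * ((1 - W t w / g (L t w)) * survival g (L t w)).

(** The coefficient, up to sign, of the payoff of round [t.+1] in the deficit
    after that round; it is already known at time [t]. *)
Let hedge (t : nat) (w : T) : R :=
  (uncrossed t w)%:R *
  ((W t w + beta t.+1 w) / g (L t.+1 w) * survival g (L t.+1 w)).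

Let mnatb : measurable_fun setT (fun b : bool => b%:R : R).
Proof. by []. Qed.

Let mginv : measurable_fun setT (fun x => (g x)^-1).
Proof.
apply: nonincreasing_measurable => // x y xy.
by rewrite lef_pV2 ?posrE ?ndg.
Qed.

Lemma measurable_deficit t : measurable_wrt (F t) (deficit t).
Proof.
have mL := @measurable_liabilities t.
apply: measurable_funM.
  exact: (measurableT_comp mnatb (@measurable_uncrossed t)).
apply: measurable_funM; last exact: (measurableT_comp msurv mL).
apply: measurable_funB; first exact: measurable_cst.
apply: measurable_funM; first exact: measurable_wealth.
exact: (measurableT_comp mginv mL).
Qed.

Lemma measurable_hedge t : measurable_wrt (F t) (hedge t).
Proof.
have mL := @measurable_liabilitiesS t.
apply: measurable_funM.
  exact: (measurableT_comp mnatb (@measurable_uncrossed t)).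
apply: measurable_funM; last exact: (measurableT_comp msurv mL).
apply: measurable_funM; first exact: measurable_stake.
exact: (measurableT_comp mginv mL).
Qed.

Lemma deficitE t w : uncrossed t w ->
  deficit t w = (1 - W t w / g (L t w)) * survival g (L t w).
Proof. by move=> u; rewrite /deficit u mul1r. Qed.

Lemma deficit0 t w : ~~ uncrossed t w -> deficit t w = 0.
Proof. by move=> /negbTE u; rewrite /deficit u mul0r. Qed.

Lemma hedgeE t w : uncrossed t w -> hedge t w =
  (W t w + beta t.+1 w) / g (L t.+1 w) * survival g (L t.+1 w).
Proof. by move=> u; rewrite /hedge u mul1r. Qed.

Lemma hedge0 t w : ~~ uncrossed t w -> hedge t w = 0.
Proof. by move=> /negbTE u; rewrite /hedge u mul0r. Qed.

Lemma deficit_ge0 t w : 0 <= deficit t w.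
Proof.
have [u|u] := boolP (uncrossed t w); last by rewrite deficit0.
rewrite deficitE// mulr_ge0//; last exact/ltW/survival_gt0.
by rewrite subr_ge0 ler_pdivrMr// mul1r ltW// uncrossedE.
Qed.

Lemma deficit_le t w : deficit t w <= (uncrossed t w)%:R.
Proof.
have [u|u] := boolP (uncrossed t w); last by rewrite deficit0.
rewrite deficitE// -[leRHS]mulr1; apply: ler_pM.
- by rewrite subr_ge0 ler_pdivrMr// mul1r ltW// uncrossedE.
- exact/ltW/survival_gt0.
- by rewrite gerBl divr_ge0 ?wealth_ge0// ltW.
- exact: survival_le1.
Qed.

Lemma hedge_ge0 t w : 0 <= hedge t w.
Proof.
rewrite mulr_ge0// mulr_ge0//; last exact/ltW/survival_gt0.
by rewrite divr_ge0 ?stake_ge0// ltW.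
Qed.

(** This is [borrowing_step]: the deficit after the borrowing and before the bet
    is [survival] minus the hedge. *)
Lemma deficit_hedge_le t w : (forall t, 0 <= beta t.+1 w) ->
  deficit t w + hedge t w <= survival g (L t.+1 w).
Proof.
move=> b0; have [u|u] := boolP (uncrossed t w); last first.
  by rewrite deficit0// hedge0// addr0; exact/ltW/survival_gt0.
have L0 : 0 <= L t w.
  by rewrite /liabilities big_add1; apply: sumr_ge0 => i _; exact: b0.
have := borrowing_step g1 ndg ndgB tail_fin L0 (b0 t) (wealth_ge0 t w)
  (uncrossedE u).
rewrite -liabilitiesS deficitE// hedgeE//.
by rewrite [X in _ <= X]mulrBl mul1r lerBrDr.
Qed.

(** After a crossing all terms vanish.  Before it, [survival g (L t.+1 w)] bounds
    the left side because of the borrowing, and it is equal to the right side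
    unless the round crosses, in which case the hedge alone pays for it.  The
    hedge is added to both sides rather than subtracted so that all integrands
    are nonnegative. *)
Lemma hedge_step t w : (forall t, 0 <= beta t.+1 w) ->
  deficit t w + hedge t w <= deficit t.+1 w + hedge t w * B t.+1 w.
Proof.
move=> b0; have [u|u] := boolP (uncrossed t w); last first.
  have u' : ~~ uncrossed t.+1 w by rewrite /= (negbTE u).
  by rewrite !deficit0// hedge0// mul0r.
apply: le_trans (deficit_hedge_le t b0) _.
rewrite hedgeE//.
have WS : W t.+1 w = (W t w + beta t.+1 w) * B t.+1 w by [].
have uS : uncrossed t.+1 w = (W t.+1 w < g (L t.+1 w)).
  by rewrite [LHS]/= u.
have [u'|u'] := boolP (uncrossed t.+1 w).
  rewrite deficitE// WS.
  move: (g0 (L t.+1 w)) (survival _ _) (W t w + _) (B _ w).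
  move: (g _) => y y0 s x b.
  by rewrite le_eqVlt; apply/orP; left; apply/eqP; field; rewrite gt_eqF.
rewrite deficit0// add0r; move: u'; rewrite uS -leNgt WS.
move: (g0 (L t.+1 w)) (survival_gt0 g (L t.+1 w)) .
move: (survival _ _) (W t w + _) (B _ w) (g _) => s x b y y0 s0 yx.
have -> : x / y * s * b = x * b / y * s by field; rewrite gt_eqF.
by rewrite ler_peMl ?(ltW s0)// ler_pdivlMr ?mul1r.
Qed.

Let mT t (X : T -> R) : measurable_wrt (F t) X ->
  measurable_fun setT (fun w => (X w)%:E).
Proof.
move=> mX; apply/measurable_EFinP; exact: (measurable_wrtW (sF t) (@Fm t)).
Qed.

(** [hedge_step] is integrated; by [integral_mul_le] the payoff can only lower
    the mean of the hedge, which is finite and cancels. *)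
Lemma integral_deficit_nd t :
  (\int[P]_w (deficit t w)%:E <= \int[P]_w (deficit t.+1 w)%:E)%E.
Proof.
have mh := mT (@measurable_hedge t).
have hfin : (\int[P]_w (hedge t w)%:E < +oo)%E.
  apply: (@le_lt_trans _ _ 1%E); last by rewrite ltry.
  rewrite -(@probability_setT _ _ _ P) -[leRHS]mul1e.
  rewrite -(@integral_cst _ _ _ P _ measurableT 1%E).
  apply: ae_ge0_le_integral => //; first by move=> w _; rewrite lee_fin hedge_ge0.
  apply: filterS ae_borrowing_ge0 => w b0 _.
  rewrite lee_fin (le_trans _ (survival_le1 g1 (L t.+1 w)))//.
  by rewrite (le_trans _ (deficit_hedge_le t b0))// lerDr deficit_ge0.
have hB : (\int[P]_w (hedge t w * B t.+1 w)%:E <= \int[P]_w (hedge t w)%:E)%E.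
  apply: (integral_mul_le (sF t) (@Fm t)).
  - apply: (measurable_wrtW (sF t.+1) (@Fm t.+1)).
    exact: (game_payoff_adapted game).
  - exact: (game_payoff_ge0 game).
  - exact: payoff_integral_le.
  - exact: measurable_hedge.
  - exact: hedge_ge0.
have mhB : measurable_fun setT (fun w => (hedge t w * B t.+1 w)%:E).
  apply: (@mT t.+1); apply: measurable_funM.
    by apply: FS; exact: measurable_hedge.
  exact: (game_payoff_adapted game).
have hfin' : (\int[P]_w (hedge t w)%:E)%E \is a fin_num.
  by rewrite ge0_fin_numE// integral_ge0// => w _; rewrite lee_fin hedge_ge0.
rewrite -(leeD2rE _ _ hfin').
apply: (@le_trans _ _ (\int[P]_w (deficit t.+1 w)%:E +
                       \int[P]_w (hedge t w * B t.+1 w)%:E)%E); last first.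
  exact: leeD2l.
have md s := mT (@measurable_deficit s).
have d0 s w : setT w -> (0 <= (deficit s w)%:E)%E.
  by rewrite lee_fin deficit_ge0.
have hB0 w : setT w -> (0 <= (hedge t w * B t.+1 w)%:E)%E.
  by move=> _; rewrite lee_fin mulr_ge0 ?hedge_ge0// (game_payoff_ge0 game).
have hh0 w : setT w -> (0 <= (hedge t w)%:E)%E by rewrite lee_fin hedge_ge0.
have Dl := ge0_integralD P measurableT (d0 t) (md t) hh0 mh.
have Dr := ge0_integralD P measurableT (d0 t.+1) (md t.+1) hB0 mhB.
apply: (@le_trans _ _ (\int[P]_w ((deficit t w)%:E + (hedge t w)%:E))%E).
  by rewrite Dl.
apply: (@le_trans _ _ (\int[P]_w ((deficit t.+1 w)%:E +
    (hedge t w * B t.+1 w)%:E))%E); last by rewrite Dr.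
apply: ae_ge0_le_integral => //.
- by move=> w Tw; apply: adde_ge0; [exact: d0|exact: hh0].
- exact: (emeasurable_funD (md t) mh).
- by move=> w Tw; apply: adde_ge0; [exact: d0|exact: hB0].
- exact: (emeasurable_funD (md t.+1) mhB).
- apply: filterS ae_borrowing_ge0 => w b0 _.
  have := hedge_step t b0.
  by rewrite -lee_fin (EFinD (deficit t w)) (EFinD (deficit t.+1 w)).
Qed.

Let start : R := (1 - (g 0)^-1) * survival g 0.

(** If [g 0 = 1] the boundary is crossed at time [0], and both sides vanish at
    [t = 0]. *)
Lemma integral_deficit_ge t : (start%:E <= \int[P]_w (deficit t w)%:E)%E.
Proof.
elim: t => [|t IH]; last exact: le_trans IH (integral_deficit_nd t).
rewrite (eq_integral (cst start%:E)).
  by rewrite (@integral_cst _ _ _ P _ measurableT start%:E)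
    [X in (_ * X)%E]probability_setT mule1.
move=> w _; congr (_%:E); have [lt1|] := boolP (uncrossed 0 w).
  by rewrite (deficitE lt1) liabilities0 -[W 0 w]/(1 : R) div1r.
rewrite -[uncrossed 0 w]/(1 < g (L 0 w)) liabilities0 -leNgt => le1.
have u0 : ~~ uncrossed 0 w.
  by rewrite -[uncrossed 0 w]/(1 < g (L 0 w)) liabilities0 -leNgt.
rewrite (deficit0 u0).
rewrite /start (_ : g 0 = 1) ?invr1 ?subrr ?mul0r//.
by apply/le_anti; rewrite le1 g1.
Qed.

Let U t : set T := [set w | ~~ uncrossed t w].

Let mU t : measurable (U t).
Proof.
have := measurable_wrtW (sF t) (@Fm t) (@measurable_uncrossed t)
  measurableT (_ : measurable [set false]).
move=> /(_ I); rewrite setTI; congr (measurable _).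
by apply/seteqP; split => w; rewrite /U/=; [move=> ->|move/negbTE].
Qed.

Lemma crossed_le t : (P (U t) <= (1 - start)%:E)%E.
Proof.
have -> : P (U t) = (1 - P (~` U t))%E.
  by have := probability_setC P (measurableC (mU t)); rewrite setCK.
rewrite EFinB leeB//.
apply: le_trans (integral_deficit_ge t) _.
rewrite -[leRHS]mul1e -(@integral_cst _ _ _ P _ (measurableC (mU t)) 1%E).
rewrite [leRHS]integral_mkcond; apply: ge0_le_integral => //.
- by move=> w _; rewrite lee_fin deficit_ge0.
- exact: mT (@measurable_deficit t).
- by apply: (iffLR (measurable_restrictT _ (measurableC (mU t)))).
- move=> w _; rewrite patchE; case: ifPn => wU.
    by rewrite lee_fin (le_trans (deficit_le t w))// lern1 leq_b1.
  move: wU; rewrite notin_setE /U/= => /contrapT wU.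
  by rewrite deficit0.
Qed.

Lemma crossing_le : (P (crossing_event g B beta) <= (1 - start)%:E)%E.
Proof.
have mc : measurable (crossing_event g B beta) by exact: measurable_crossing_event.
have sub : crossing_event g B beta `<=` \bigcup_t U t.
  move=> w [t [L0 gW]]; exists t => //; rewrite /U/=.
  by apply: contraL gW => /uncrossedE; rewrite -ltNge.
have mbU : measurable (\bigcup_t U t) by exact: bigcupT_measurable.
apply: le_trans (le_measure P (mem_set mc) (mem_set mbU) sub) _.
have cvgU : P \o U @ \oo --> P (\bigcup_t U t).
  apply: nondecreasing_cvg_mu => //.
  apply/nondecreasing_seqP => t; rewrite subsetEset => w; rewrite /U/=.
  by apply: contra => /andP[].
apply: (cvge_to_le cvgU); apply: nearW => t; exact: crossed_le.
Qed.

End upper_bound.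

(** * Games decided by one success time *)

Section uniform_interval.
Context (R : realType).
Notation PU := (uniform_prob (@ltr01 R)).

Lemma uniform_prob_itv (U : set R) (a b : R) : measurable U -> a <= b ->
  U `&` `[0, 1] = `[a, b[%classic -> PU U = (b - a)%:E.
Proof.
move=> mU ab UE; rewrite /uniform_prob integral_uniform_pdf UE.
rewrite (eq_integral (cst 1%E)); last first.
  move=> x; rewrite -UE inE => -[_ /=]; rewrite in_itv/= /uniform_pdf => ->.
  by rewrite subr0 invr1.
rewrite integral_cst//= mul1e lebesgue_measure_itv/= lte_fin.
by move: ab; rewrite le_eqVlt => /predU1P[->|->//]; rewrite ltxx subrr.
Qed.

End uniform_interval.

Section hazard_game.
Context (R : realType) (h b : nat -> R).
Hypothesis h0 : forall t, 0 < h t.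
Hypothesis h1 : forall t, h t <= 1.
Hypothesis b0 : forall t, 0 <= b t.

Notation PU := (uniform_prob (@ltr01 R)).
Let T : measurableType _ := measurableTypeR R.

(** [h t] is the conditional probability that round [t.+1] succeeds. *)
Fixpoint alive (t : nat) : R := if t is s.+1 then alive s * (1 - h s) else 1.

Lemma alive_ge0 t : 0 <= alive t.
Proof. by elim: t => //= t IH; rewrite mulr_ge0// subr_ge0. Qed.

Lemma alive_decr t : alive t.+1 <= alive t.
Proof. by rewrite /= ler_piMr ?alive_ge0// gerBl ltW. Qed.

Lemma alive_nonincreasing s t : (s <= t)%N -> alive t <= alive s.
Proof.
have /nonincreasing_seqP nialive : forall n, alive n.+1 <= alive n := alive_decr.
exact: nialive.
Qed.

Lemma alive_le1 t : alive t <= 1.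
Proof. exact: (@alive_nonincreasing 0). Qed.

Let I t : set T := [set w : R | w < alive t].

Let mI t : measurable (I t).
Proof. by rewrite /I -set_itvNyo. Qed.

(** At time [t] the time of success is known if it is at most [t], and nothing
    else is known about the failures [I t]: an event must not split them.  The
    filtration is finer than the one generated by the payoffs, for it reveals
    the whole sample point at the success, which changes no conditional
    expectation because all later payoffs vanish there. *)
Definition hazard_filtration (t : nat) : set (set T) :=
  [set A | measurable A /\ (I t `<=` A \/ I t `<=` ~` A)].

Lemma hazard_filtrationP : filtration hazard_filtration.
Proof.
split.
- move=> t; split.
  + by split; [exact: measurable0|right => w _ []].
  + move=> A [mA IA]; rewrite setTD; split; first exact: measurableC.
    by rewrite setCK; case: IA; [right|left].
  + move=> A FA; split; first by apply: bigcupT_measurable => i; case: (FA i).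
    have [[i IA]|noI] := pselect (exists i, I t `<=` A i).
      by left => w Iw; exists i => //; exact: IA.
    right => w Iw [i _ Aw]; case: (FA i) => _ [IA|]; last by move=> /(_ w Iw).
    by apply: noI; exists i.
- by move=> t A [].
- move=> s t st A [mA IA]; split=> //.
  have sI : I t `<=` I s by move=> w /lt_le_trans; apply; exact: alive_nonincreasing.
  by case: IA => IA; [left|right]; exact: subset_trans sI IA.
Qed.

(** A preimage under a function that does not distinguish the failures cannot
    split them. *)
Lemma measurable_hazard d' (U : measurableType d') (X : T -> U) t :
  measurable_fun setT X -> (forall w w', I t w -> I t w' -> X w = X w') ->
  measurable_wrt (hazard_filtration t) X.
Proof.
move=> mX cX _ Y mY.
have sF := filtration_sigma hazard_filtrationP t.
suff : hazard_filtration t (setT `&` X @^-1` Y).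
  by rewrite -[hazard_filtration t in X in X -> _](measurable_g_measurableTypeE sF).
split; first exact: mX.
rewrite setTI.
have [[w [Iw Yw]]|no] := pselect (exists w, I t w /\ Y (X w)).
  by left => w' Iw'; rewrite /preimage/= (cX _ _ Iw' Iw).
by right => w Iw Yw; apply: no; exists w.
Qed.

Let D t : set T := [set w : R | alive t.+1 <= w < alive t].

Let mD t : measurable (D t).
Proof. by rewrite /D -set_itvco. Qed.

(** The factor [(h t)^-1] makes the bet fair given that all earlier rounds
    failed. *)
Definition hazard_payoff (t : nat) (w : T) : R :=
  if t is s.+1 then (h s)^-1 * \1_(D s) w else 0.

Definition hazard_borrowing (t : nat) (w : T) : R := if t is s.+1 then b s else 0.

Lemma hazard_payoff_ge0 t w : 0 <= hazard_payoff t.+1 w.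
Proof. by rewrite /= mulr_ge0 ?invr_ge0 ?(ltW (h0 t)). Qed.

Lemma measurable_hazard_payoff t : measurable_fun setT (hazard_payoff t.+1).
Proof. by apply: measurable_funM => //; exact: measurable_indic. Qed.

Lemma hazard_wealth_ge0 t w : 0 <= wealth hazard_payoff hazard_borrowing t w.
Proof.
elim: t => // t IH; rewrite [wealth _ _ _ _]/=.
by rewrite mulr_ge0 ?addr_ge0 ?b0// hazard_payoff_ge0.
Qed.

Lemma hazard_gameP :
  borrowed_betting_game hazard_filtration hazard_payoff hazard_borrowing.
Proof.
split.
- exact: hazard_filtrationP.
- exact: hazard_payoff_ge0.
- move=> t; apply: measurable_hazard; first exact: measurable_hazard_payoff.
  suff E w : I t.+1 w -> hazard_payoff t.+1 w = 0 by move=> w w' /E-> /E->.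
  rewrite /I /D /= => Iw; rewrite indicE memNset ?mulr0//= => /andP[].
  by rewrite leNgt Iw.
- by move=> t; apply: measurable_hazard => //; exact: measurable_cst.
- move=> t w; rewrite (@le_trans _ _ 0) ?b0//.
  by rewrite oppr_le0 hazard_wealth_ge0.
Qed.

Lemma uniform_prob_I t : PU (I t) = (alive t)%:E.
Proof.
have E : I t `&` `[0, 1] = `[0, alive t[%classic.
  apply/seteqP; split => w /=; rewrite !in_itv/=; first by move=> [-> /andP[-> _]].
  move=> /andP[-> wt]; split=> //=.
  by rewrite (le_trans (ltW wt))// alive_le1.
by rewrite (uniform_prob_itv (mI t) (alive_ge0 t) E) subr0.
Qed.

Lemma uniform_prob_D t : PU (D t) = (alive t - alive t.+1)%:E.
Proof.
apply: (uniform_prob_itv (mD t) (alive_decr t)).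
apply/seteqP; split => w /=; rewrite !in_itv/=; first by move=> [/andP[-> ->]].
move=> /andP[aw wt]; rewrite /D/= aw wt; split=> //=.
by rewrite (le_trans (alive_ge0 t.+1) aw) (le_trans (ltW wt))// alive_le1.
Qed.

(** The conditional mean of the payoff is [1] as long as all rounds have failed
    and [0] afterwards; an event known at time [t] contains all of the failures
    [I t] or none, and in both cases the two integrals are explicit. *)
Lemma hazard_null : supermartingale_null PU hazard_filtration hazard_payoff.
Proof.
move=> t; exists (fun w => (\1_(I t) w)%:E); last first.
  by apply: nearW => w; rewrite lee_fin indicE lern1 leq_b1.
split.
- by move=> w; rewrite lee_fin indicE ler0n.
- apply: measurable_hazard; first by apply/measurable_EFinP; exact: measurable_indic.
  by move=> w w' Iw Iw'; rewrite !indicE !mem_set.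
- move=> A [mA IA].
  rewrite integral_indic// -/PU.
  under [RHS]eq_integral do rewrite /= EFinM.
  have mDA : measurable_fun A (fun w => (\1_(D t) w)%:E : \bar R).
    by apply/measurable_EFinP/measurable_funTS; exact: measurable_indic.
  rewrite (ge0_integralZl _ mA mDA) ?lee_fin ?invr_ge0 ?(ltW (h0 t))//.
  rewrite integral_indic//.
  have DI : D t `<=` I t by move=> w /andP[].
  case: IA => IA.
    rewrite !setIidl//; last exact: subset_trans DI IA.
    rewrite [LHS]uniform_prob_I [X in (_ * X)%E]uniform_prob_D -EFinM; congr (_%:E).
    by rewrite /=; field; rewrite gt_eqF.
  have -> : I t `&` A = set0 by apply/seteqP; split => w // [/IA].
  have -> : D t `&` A = set0 by apply/seteqP; split => w // [/DI/IA].
  by rewrite !measure0 mule0.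
Qed.

Lemma hazard_nondecreasing : nondecreasing_liabilities PU hazard_borrowing.
Proof.
move=> t; rewrite (_ : [set w | _] = setT) ?probability_setT//.
by apply/seteqP; split => w //= _; exact: b0.
Qed.

(** Earlier failures leave no wealth, except for the initial unit when the
    success comes in the first round. *)
Lemma hazard_wealthS t w : D t w ->
  wealth hazard_payoff hazard_borrowing t.+1 w = ((t == 0)%:R + b t) / h t.
Proof.
move=> Dw; rewrite /= indicE mem_set// mulr1; congr ((_ + _) * _).
case: t Dw => [|t] //= /andP[_ wt].
by rewrite indicE memNset ?mulr0 ?mulr0//= => /andP[]; rewrite leNgt wt.
Qed.

Lemma hazard_liabilities t w :
  liabilities hazard_borrowing t w = \sum_(i < t) b i.
Proof. by rewrite /liabilities big_add1 big_mkord. Qed.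

Lemma hazard_crossing (g : R -> R) N : measurable_fun setT g ->
  (forall t, g (\sum_(i < t.+1) b i) <= ((t == 0)%:R + b t) / h t) ->
  ((1 - alive N)%:E <=
   PU (crossing_event g hazard_payoff hazard_borrowing))%E.
Proof.
move=> mg gh.
have hit n w : alive n <= w < 1 -> exists t, D t w.
  elim: n => [|n IH] /andP[aw w1]; first by rewrite leNgt w1 in aw.
  have [wn|nw] := ltP w (alive n); first by exists n; rewrite /D/= aw.
  by apply: IH; rewrite nw.
have mJ : measurable [set w : R | alive N <= w < 1] by rewrite -set_itvco.
have E : [set w : R | alive N <= w < 1] `&` `[0, 1] = `[alive N, 1[%classic.
  apply/seteqP; split => w /=; rewrite !in_itv/=; first by move=> [].
  move=> /andP[aw w1]; rewrite aw w1 (ltW w1); split=> //.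
  by rewrite (le_trans (alive_ge0 N) aw).
rewrite -(uniform_prob_itv mJ (alive_le1 N) E).
apply: le_measure; rewrite ?inE//.
  exact: (measurable_crossing_event hazard_gameP).
move=> w /hit[t Dw]; exists t.+1.
by rewrite hazard_wealthS// hazard_liabilities gh sumr_ge0.
Qed.

End hazard_game.

(** * Borrowing in small steps *)

Section fine_borrowing.
Context (R : realType) (g : R -> R).
Hypothesis g1 : forall l, 1 <= g l.
Hypothesis ndg : forall l1 l2, l1 <= l2 -> g l1 <= g l2.
Hypothesis ndgB : forall l1 l2, 0 <= l1 -> l1 <= l2 -> g l1 - l1 <= g l2 - l2.

Notation mu := lebesgue_measure.

Let g0 l : 0 < g l. Proof. exact: lt_le_trans (g1 l). Qed.

Let ig0 l : (0 <= ((g l)^-1)%:E)%E.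
Proof. by rewrite lee_fin invr_ge0; exact: ltW. Qed.

Lemma integral_inv_boundary_le (a b : R) : a <= b ->
  (\int[mu]_(x in `[a, b[) ((g x)^-1)%:E <= ((b - a) / g a)%:E)%E.
Proof.
move=> ab; apply: (@le_trans _ _ (\int[mu]_(x in `[a, b[) (cst ((g a)^-1)%:E x))%E).
  apply: ge0_le_integral => //; first exact: measurable_inv_boundary.
  move=> x /=; rewrite in_itv/= => /andP[ax _].
  by rewrite lee_fin lef_pV2 ?posrE// ndg.
rewrite integral_cst//= lebesgue_measure_itv/= lte_fin.
move: ab; rewrite le_eqVlt => /predU1P[->|->].
  by rewrite ltxx mule0 subrr mul0r.
by rewrite -EFinD -EFinM mulrC.
Qed.

Definition head_integral (x : R) : R :=
  fine (\int[mu]_(l in `[0%R, x[) ((g l)^-1)%:E)%E.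

Lemma head_integral_fin_num x : 0 <= x ->
  (\int[mu]_(l in `[0%R, x[) ((g l)^-1)%:E)%E \is a fin_num.
Proof.
move=> x0; rewrite ge0_fin_numE ?integral_ge0//.
exact: le_lt_trans (integral_inv_boundary_le x0) (ltry _).
Qed.

Lemma head_integral0 : head_integral 0 = 0.
Proof. by rewrite /head_integral set_itvco0 integral_set0. Qed.

Lemma head_integral_step (x e : R) : 0 <= x -> 0 <= e ->
  head_integral (x + e) <= head_integral x + e / g x.
Proof.
move=> x0 e0; have xe : x <= x + e by rewrite lerDl.
have xe0 : 0 <= x + e by rewrite addr_ge0.
rewrite -lee_fin EFinD !fineK ?head_integral_fin_num//.
have -> : `[0, x + e[%classic = `[0, x[ `|` `[x, x + e[ :> set R.
  by rewrite -itv_bndbnd_setU//= bnd_simp.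
rewrite ge0_integral_setU//; last 2 first.
- by apply: measurable_inv_boundary => //; exact: measurableU.
- apply/disj_setPS => y [] /=; rewrite !in_itv/= => /andP[_ yx] /andP[xy _].
  by rewrite leNgt yx in xy.
rewrite leeD2l// (le_trans (integral_inv_boundary_le xe))//.
by rewrite lee_fin addrAC subrr add0r.
Qed.

Variable e : R.
Hypothesis e0 : 0 < e.

(** The first round stakes the initial wealth and nothing is borrowed for it; the
    hazards [h] below are those for which a success lands exactly on the
    boundary. *)
Let b (t : nat) : R := if t is 0 then 0 else e.
Let h (t : nat) : R := (if t is 0 then 1 else e) / g (t%:R * e).

Let b0 t : 0 <= b t.
Proof. by case: t => //= _; exact: ltW. Qed.

Let te0 t : 0 <= t%:R * e.
Proof. by rewrite mulr_ge0 ?ler0n// ltW. Qed.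

Let h0 t : 0 < h t.
Proof. by case: t => [|t]; rewrite /h divr_gt0. Qed.

Let h1 t : h t <= 1.
Proof.
rewrite /h ler_pdivrMr// mul1r; case: t => [//|t].
have := ndgB (lexx 0) (te0 t.+1); have := g1 0.
have : e <= t.+1%:R * e by rewrite ler_peMl ?ler1n// ltW.
by lra.
Qed.

Let sumb t : \sum_(i < t.+1) b i = t%:R * e.
Proof.
rewrite big_ord_recl/= add0r (eq_bigr (fun=> e))//.
by rewrite sumr_const card_ord mulr_natl.
Qed.

(** The round with liabilities [k * e] fails with probability at most
    [exp (- e / g (k * e))], and since [1 / g] is nonincreasing the exponent
    dominates the integral of [1 / g] from [k * e] to [(k + 1) * e].  As [k]
    starts at [1], only the integral from [0] to [e] is lost. *)
Lemma alive_le_expR N : alive h N.+1 <=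
  (1 - (g 0)^-1) * expR (head_integral e - head_integral (N.+1%:R * e)).
Proof.
elim: N => [|N IH]; first by rewrite /= /h mul0r !mul1r subrr expR0 mulr1.
rewrite [alive _ _]/=.
apply: (@le_trans _ _ ((1 - (g 0)^-1) *
    expR (head_integral e - head_integral (N.+1%:R * e)) * (1 - h N.+1))).
  by rewrite ler_wpM2r// subr_ge0.
rewrite -mulrA ler_wpM2l//; first by rewrite subr_ge0 invf_le1.
apply: (@le_trans _ _ (expR (head_integral e - head_integral (N.+1%:R * e)) *
    expR (- h N.+1))).
  by rewrite ler_wpM2l ?expR_ge0// expR_ge1Dx.
rewrite -expRD ler_expR.
have := head_integral_step (te0 N.+1) (ltW e0).
by rewrite -[N.+2%:R]natr1 mulrDl mul1r /h; lra.
Qed.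

Lemma fine_borrowing_game N :
  exists (d : measure_display) (T : measurableType d) (P : probability T R)
    (F : nat -> set (set T)) (B beta : nat -> T -> R),
  [/\ borrowed_betting_game F B beta, supermartingale_null P F B,
      nondecreasing_liabilities P beta &
      ((1 - (1 - (g 0)^-1) * expR (e - head_integral (N.+1%:R * e)))%:E
       <= P (crossing_event g B beta))%E].
Proof.
exists _, (measurableTypeR R), (uniform_prob (@ltr01 R)), (hazard_filtration h),
  (hazard_payoff h), (hazard_borrowing b); split.
- exact: hazard_gameP.
- exact: hazard_null.
- exact: hazard_nondecreasing.
- have mg : measurable_fun setT g := nondecreasing_measurable measurableT ndg.
  apply: le_trans (@hazard_crossing _ h b h0 h1 b0 g N.+1 mg _).
    rewrite lee_fin lerD2l lerN2 (le_trans (alive_le_expR N))//.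
    rewrite ler_wpM2l//; first by rewrite subr_ge0 invf_le1.
    rewrite ler_expR lerD2r.
    have := head_integral_step (lexx 0) (ltW e0).
    rewrite add0r head_integral0 add0r => /le_trans; apply.
    by rewrite ler_pdivrMr// ler_peMr// ltW.
  move=> t; rewrite sumb /h.
  by case: t => [|t]; rewrite /b/= ?addr0 ?add0r; rewrite le_eqVlt;
    apply/orP; left; apply/eqP; field; rewrite !gt_eqF.
Qed.

End fine_borrowing.

(** * The bound as a supremum *)

Section crossing_bound.
Context (R : realType) (g : R -> R).
Hypothesis g1 : forall l, 1 <= g l.
Hypothesis ndg : forall l1 l2, l1 <= l2 -> g l1 <= g l2.
Hypothesis ndgB : forall l1 l2, 0 <= l1 -> l1 <= l2 -> g l1 - l1 <= g l2 - l2.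

Let g0 l : 0 < g l. Proof. exact: lt_le_trans (g1 l). Qed.

Lemma crossing_boundE : crossing_bound g =
  (1 - (1 - (g 0)^-1)%:E * expeR (- tail_integral g 0))%E.
Proof.
by rewrite /crossing_bound -/(tail_integral g 0) mulrBl divff ?gt_eqF// mul1r.
Qed.

Lemma crossing_bound_fin (u : R) : tail_integral g 0 = u%:E ->
  crossing_bound g = (1 - (1 - (g 0)^-1) * expR (- u))%:E.
Proof. by rewrite crossing_boundE => ->. Qed.

Lemma crossing_bound_infty : tail_integral g 0 = +oo%E -> crossing_bound g = 1%E.
Proof.
rewrite crossing_boundE => ->; rewrite (_ : expeR (- +oo) = 0)%E//.
by rewrite mule0 sube0.
Qed.

Lemma crossing_le_bound (d : measure_display) (T : measurableType d)
    (P : probability T R) (F : nat -> set (set T)) (B beta : nat -> T -> R) :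
  borrowed_betting_game F B beta -> supermartingale_null P F B ->
  nondecreasing_liabilities P beta ->
  (P (crossing_event g B beta) <= crossing_bound g)%E.
Proof.
move=> game null ndL.
have mg : measurable_fun setT g := nondecreasing_measurable measurableT ndg.
have := tail_integral_ge0 g1 0; case E : (tail_integral g 0) => [u| |//] _.
  rewrite (crossing_bound_fin E).
  have fin : (tail_integral g 0 < +oo)%E by rewrite E ltry.
  have := crossing_le game null ndL g1 ndg ndgB fin.
  by rewrite /survival maxxx E.
rewrite (crossing_bound_infty E); apply: probability_le1.
exact: (measurable_crossing_event game).
Qed.

Lemma cvg_head_integral :
  ((head_integral g n.+1%:R)%:E @[n --> \oo] --> tail_integral g 0)%E.
Proof.
have -> : tail_integral g 0 =
    (\int[lebesgue_measure]_(l in \bigcup_n `[0%R, n.+1%:R[%classic)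
       ((g l)^-1)%:E)%E.
  rewrite /tail_integral; congr (integral _ _ _).
  apply/seteqP; split => x /=.
    rewrite in_itv/= andbT => x0; exists (Num.truncn x) => //=.
    by rewrite in_itv/= x0 truncnS_gt.
  by move=> [n _] /=; rewrite !in_itv/= andbT => /andP[].
under eq_fun do rewrite fineK ?head_integral_fin_num//.
apply: ge0_nondecreasing_set_cvg_integral.
- move=> m n mn; rewrite subsetEset => x /=; rewrite !in_itv/= => /andP[-> xm]/=.
  by rewrite (lt_le_trans xm)// ler_nat.
- by move=> n; exact: measurable_itv.
- by move=> n; exact: measurable_inv_boundary.
- by move=> n x _; rewrite lee_fin invr_ge0 ltW.
Qed.

Lemma cvg_fine_bound :
  ((1 - (1 - (g 0)^-1) * expR (n.+1%:R^-1 - head_integral g n.+1%:R))%:E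
    @[n --> \oo] --> crossing_bound g)%E.
Proof.
have cinv : expR (n.+1%:R^-1 : R) @[n --> \oo] --> (1 : R).
  rewrite -[X in _ --> X]expR0; apply: continuous_cvg; first exact: continuous_expR.
  exact: (@cvg_harmonic R).
have [u [-> cu]] : exists u, crossing_bound g = (1 - (1 - (g 0)^-1) * u)%:E /\
    expR (- head_integral g n.+1%:R) @[n --> \oo] --> u.
  have := tail_integral_ge0 g1 0; have := cvg_head_integral.
  case E : (tail_integral g 0) => [u| |//] cJ _.
    exists (expR (- u)); split; first exact: crossing_bound_fin.
    apply: continuous_cvg; first exact: continuous_expR.
    by apply: cvgN; have /fine_cvgP[] := cJ.
  exists 0; rewrite mulr0 subr0; split; first exact: crossing_bound_infty.
  by apply: cvg_comp (@cvgr_expR R); exact/cvgeryP.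
apply: cvg_EFin; first exact: nearW.
apply: cvgB; first exact: cvg_cst.
apply: cvgM; first exact: cvg_cst.
rewrite -[u]mul1r; under eq_fun do rewrite expRD.
exact: cvgM.
Qed.

(** With [e = 1 / (n + 1)] and [N + 1 = (n + 1) ^ 2] the integral that appears
    in [fine_borrowing_game] extends to [n + 1], so that one index drives both
    the step to [0] and the horizon to infinity. *)
Lemma crossing_bound_le_sup (x : \bar R) :
  (forall (d : measure_display) (T : measurableType d) (P : probability T R)
      (F : nat -> set (set T)) (B beta : nat -> T -> R),
    borrowed_betting_game F B beta ->
    supermartingale_null P F B ->
    nondecreasing_liabilities P beta ->
    (P (crossing_event g B beta) <= x)%E) ->
  (crossing_bound g <= x)%E.
Proof.
move=> le_x; apply: (cvge_to_le cvg_fine_bound); apply: nearW => n.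
have e0 : 0 < n.+1%:R^-1 :> R by rewrite invr_gt0.
have [d [T [P [F [B [beta [game null ndL]]]]]]] :=
  fine_borrowing_game g1 ndg ndgB e0 (n.+1 * n.+1).-1.
rewrite prednK ?muln_gt0// natrM mulfK ?pnatr_eq0// => /le_trans; apply.
exact: le_x game null ndL.
Qed.

End crossing_bound.

(** The boundary is arbitrary on the negative reals; freezing it there at [g 0]
    makes it monotone, hence Borel, on the whole line without changing the event
    or the bound. *)
Section extension.
Context (R : realType) (g : R -> R).
Hypothesis hg : boundary g.

Let gx (l : R) := g (Num.max l 0).

Lemma extension_ge1 l : 1 <= gx l.
Proof. by case: hg => g1 _; apply: g1; rewrite le_max lexx orbT. Qed.

Lemma extension_nondecreasing l1 l2 : l1 <= l2 -> gx l1 <= gx l2.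
Proof.
move=> l12; case: hg => _ ndgB.
have l12' : Num.max l1 0 <= Num.max l2 0 by rewrite ge_max !le_max l12 lexx orbT.
have := ndgB _ _ _ l12'; rewrite le_max lexx orbT => /(_ isT).
by rewrite /gx; lra.
Qed.

Lemma extension_sub_nondecreasing l1 l2 :
  0 <= l1 -> l1 <= l2 -> gx l1 - l1 <= gx l2 - l2.
Proof.
move=> l0 l12; rewrite /gx !max_l//; last exact: le_trans l12.
by case: hg => _; apply.
Qed.

Lemma crossing_event_extension (T : Type) (B beta : nat -> T -> R) :
  crossing_event gx B beta = crossing_event g B beta.
Proof.
by apply/seteqP; split => w [t [L0]] gW; exists t; split=> //;
  move: gW; rewrite /gx max_l.
Qed.

Lemma crossing_bound_extension : crossing_bound gx = crossing_bound g.
Proof.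
rewrite /crossing_bound /gx maxxx; congr (_ - _ * expeR (- _))%E.
apply: eq_integral => x; rewrite inE/= in_itv/= andbT => x0.
by rewrite max_l.
Qed.

End extension.

Unset Implicit Arguments.

Theorem theorem3p1 (R : realType) (g : R -> R) (hg : boundary g) :
  (forall (d : measure_display) (T : measurableType d) (P : probability T R)
      (F : nat -> set (set T)) (B beta : nat -> T -> R),
    borrowed_betting_game F B beta ->
    supermartingale_null P F B ->
    nondecreasing_liabilities P beta ->
    (P (crossing_event g B beta) <= crossing_bound g)%E) /\
  ereal_sup [set p : \bar R |
    exists (d : measure_display) (T : measurableType d) (P : probability T R)
      (F : nat -> set (set T)) (B beta : nat -> T -> R),
    [/\ borrowed_betting_game F B beta,
        supermartingale_null P F B,
        nondecreasing_liabilities P beta &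
        p = P (crossing_event g B beta)]] = crossing_bound g.
Proof.
have g1 := extension_ge1 hg.
have ndg := extension_nondecreasing hg.
have ndgB := extension_sub_nondecreasing hg.
have upper d (T : measurableType d) (P : probability T R) F B beta :
    borrowed_betting_game F B beta -> supermartingale_null P F B ->
    nondecreasing_liabilities P beta ->
    (P (crossing_event g B beta) <= crossing_bound g)%E.
  rewrite -crossing_event_extension -crossing_bound_extension.
  exact: crossing_le_bound.
split; first exact: upper.
apply/le_anti/andP; split.
  apply: ge_ereal_sup => _ [d [T [P [F [B [beta [game null ndL ->]]]]]]].
  exact: upper game null ndL.
rewrite -crossing_bound_extension; apply: crossing_bound_le_sup => //.
move=> d T P F B beta game null ndL.
rewrite crossing_event_extension; apply: ereal_sup_ubound.
by exists d, T, P, F, B, beta.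
Qed.
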